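(* Let $b\ge2$ be an integer, let $n$ be a positive integer (the number of summands), and let $p\ge1$ satisfy $\frac{b-1}{p}\in\mathbf N$ (for the upper signs), respectively $\frac{b+1}{p}\in\mathbf N$ (for the lower signs). Let $\{\kappa_r^{\pm}\}_{r\ge0}$ be the $(\pm b,n,p)$-carries process. Then for every $i\in\mathcal C_p(n)$ and all integers $r,s\ge0$: (1) $\displaystyle \mathbf E[\kappa_r^{\pm}\mid\kappa_0^{\pm}=i]=\frac{1}{(\pm b)^r}\left(i+\frac1p-\frac{n+1}{2}\right)-\frac1p+\frac{n+1}{2}$; (2) $\displaystyle \mathrm{Var}(\kappa_r^{\pm}\mid\kappa_0^{\pm}=i)=\frac{n+1}{12}\left(1-\frac{1}{(\pm b)^{2r}}\right)$; (3) $\displaystyle \mathrm{Cov}(\kappa_s^{\pm},\kappa_{s+r}^{\pm}\mid\kappa_0^{\pm}=i)=\frac{1}{(\pm b)^r}\,\frac{n+1}{12}\left(1-\frac{1}{(\pm b)^{2s}}\right)$.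
   Context: $\mathbf N$ is the set of positive integers. $\mathcal D(b)=\{0,1,\dots,b-1\}$. $\mathcal C_p(n)=\{0,1,\dots,n-1\}$ if $p=1$ and $\mathcal C_p(n)=\{0,1,\dots,n\}$ if $p\neq 1$. The $(\pm b,n,p)$-carries process $\{\kappa_k^{\pm}\}_{k\ge 0}$ is the Markov chain on $\mathcal C_p(n)$ defined as follows. Given $\kappa^{\pm}_{k-1}$, draw $Y_1,\dots,Y_n$ independently and uniformly from $\mathcal D(b)$ (independently of the past); then $\kappa_k^{\pm}$ is the unique integer for which there is $s\in\mathcal D(b)$ with $$\kappa^{+}_{k-1}+Y_1+\dots+Y_n+A_+(b)=\kappa^+_k\,b+s \quad\text{(for }+b),\qquad \kappa^{-}_{k-1}+Y_1+\dots+Y_n+A_-(b)=(n-\kappa^-_k)\,b+s\quad\text{(for }-b),$$ where $A_+(b)=(b-1)\left(1-\frac1p\right)$ and $A_-(b)=\frac{b+1}{p}-1$. Expectation, variance and covariance are conditional on $\kappa_0^\pm=i$.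
   Formalization: Parts (2) and (3) are stated only for n ≥ 2, since they fail for n = 1 (for n = p = 1 the process is constantly 0 with variance 0, while the formula is positive for r ≥ 1); part (1) is stated for all n ≥ 1. *)

(* Defs.v *)
From HB Require Import structures.
From mathcomp Require Export all_boot all_order all_algebra.
From mathcomp Require Export all_classical all_reals all_analysis.

Set Implicit Arguments.
Unset Strict Implicit.
Unset Printing Implicit Defensive.

Import Order.TTheory GRing.Theory Num.Theory.
Import numFieldNormedType.Exports.

Local Open Scope classical_set_scope.
Local Open Scope ring_scope.

(* Throughout, [neg : bool] selects the sign: [false] is the process for +b,
   [true] the one for -b, and [pm neg] is the corresponding +1 or -1. *)
Definition pm (R : realType) (neg : bool) : R := if neg then -1 else 1.

(* [p] is a real parameter: (b -+ 1)/p must be an integer, p itself need not. *)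
Definition inC (R : realType) (p : R) (n j : nat) : bool :=
  if p == 1 then (j < n)%N else (j <= n)%N.

Definition shift (R : realType) (neg : bool) (b : nat) (p : R) : R :=
  if neg then (b%:R + 1) / p - 1 else (b%:R - 1) * (1 - 1 / p).

(* [carry neg b p y i j]: j is the next carry when the current carry is i and
   the digits drawn are y 0, ..., y (n-1). *)
Definition carry (R : realType) (neg : bool) (b n : nat) (p : R)
    (y : {ffun 'I_n -> 'I_b}) (i j : nat) : bool :=
  [exists s : 'I_b,
    i%:R + \sum_(l < n) (y l)%:R + shift neg b p ==
      (if neg then n%:R - j%:R else j%:R) * b%:R + s%:R :> R].

(* The n digits being independent and uniform on {0, ..., b-1}, y is uniform
   on the finite set of digit vectors. *)
Definition trans (R : realType) (neg : bool) (b n : nat) (p : R)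
    (i j : nat) : R :=
  #|[pred y : {ffun 'I_n -> 'I_b} | carry neg p y i j]|%:R / (b ^ n)%:R.

(* The Markov property with transition probabilities [trans]; in product form,
   so that histories of probability 0 need no separate treatment. *)
Definition carries_process (R : realType) (d : measure_display)
    (T : measurableType d) (P : probability T R) (neg : bool) (b n : nat)
    (p : R) (kappa : nat -> {RV P >-> nat}) : Prop :=
  (forall k w, inC p n (kappa k w)) /\
  (forall (k : nat) (x : nat -> nat), (forall l, inC p n (x l)) ->
     P [set w | forall l, (l <= k.+1)%N -> kappa l w = x l] =
     (P [set w | forall l, (l <= k)%N -> kappa l w = x l] *
        (trans neg b n p (x k) (x k.+1))%:E)%E).

Lemma measurable_level (R : realType) (d : measure_display)
    (T : measurableType d) (P : probability T R) (X : {RV P >-> nat})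
    (i : nat) : measurable (X @^-1` [set i]).
Proof. exact: measurable_funPTI. Qed.

(* The conditional probability B |-> P (B `&` {X = i}) / P {X = i}. If
   P {X = i} = 0, [mnormalize] returns its default, here P. *)
Definition cond_prob (R : realType) (d : measure_display)
    (T : measurableType d) (P : probability T R) (X : {RV P >-> nat})
    (i : nat) : probability T R :=
  mnormalize (mrestr P (measurable_level X i)) P.

(* Main.v *)
Require Import Defs.
From mathcomp Require Import all_boot all_order all_algebra.
From mathcomp Require Import all_classical all_reals all_analysis.
From mathcomp Require Import zify ring lra.

Set Implicit Arguments.
Unset Strict Implicit.
Unset Printing Implicit Defensive.

Import Order.TTheory GRing.Theory Num.Theory.
Import numFieldNormedType.Exports.

Local Open Scope classical_set_scope.
Local Open Scope ring_scope.

(** Why the theorem holds. Write [c = (n+1)/2 - 1/p] for the limiting mean and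
[B] for the signed base. Draw the digits [y] and let [Z] be the current carry
plus the digit sum plus the shift, so that the next carry is the quotient of
[Z] by [b], or [n] minus it for the negative base. Replacing the quotient by
[(Z - Z mod b) / b] and centring every digit at [(b-1)/2], all the constants
collapse and both signs give the same identity:

  next carry - c  =  (carry - c + D) / B,
  D = sum of the centred digits - the centred remainder of [Z] mod [b].

This is [next_carry_noise]. The remainder is itself a uniform digit, since
rotating one digit mod [b] rotates it ([avg_resample]). So [D] is centred, which
gives the mean. When [n >= 2] the remainder is moreover uncorrelated with each
digit, because another digit is left to be rotated; [D] is then a signed sum of
[n+1] pairwise uncorrelated variables of variance [(b^2-1)/12], and its variance
is [(n+1)(b^2-1)/12] whatever the current carry. For [n = 1] the remainder and
the digit are correlated and this breaks down.

Hence [carry - c] is divided by [B] at each step and a constant variance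
[(n+1)/12 (1 - B^-2)] is added. Iterating this along the chain gives the mean
and the variance, and, when only the later of two times is advanced, the
covariance. The passage from one step to the chain is [markov_step], which
reduces expectations to finite sums over trajectories. Conditioning on the
initial carry preserves the product form of the Markov property
([cond_carries_process]), so the process may be assumed to start at [i]. *)

(** * Averages over uniform digits *)

Definition avg (R : realType) (F : finType) (g : F -> R) : R :=
  (\sum_x g x) / #|F|%:R.

Lemma eq_avg (R : realType) (F : finType) (g h : F -> R) :
  g =1 h -> avg g = avg h.
Proof. by move=> gh; congr (_ / _); apply: eq_bigr => x _; exact: gh. Qed.

Lemma avgD (R : realType) (F : finType) (g h : F -> R) :
  avg (fun x => g x + h x) = avg g + avg h.
Proof. by rewrite /avg big_split mulrDl. Qed.

Lemma avgZ (R : realType) (F : finType) (a : R) (g : F -> R) :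
  avg (fun x => a * g x) = a * avg g.
Proof. by rewrite /avg -mulr_sumr mulrA. Qed.

Lemma avg_cst (R : realType) (F : finType) (a : R) :
  (0 < #|F|)%N -> avg (fun _ : F => a) = a.
Proof.
move=> F0; rewrite /avg sumr_const -(mulr_natr a) mulfK//.
by rewrite pnatr_eq0 -lt0n.
Qed.

Lemma avg_sum (R : realType) (F I : finType) (g : I -> F -> R) :
  avg (fun x => \sum_i g i x) = \sum_i avg (g i).
Proof. by rewrite /avg exchange_big mulr_suml. Qed.

(** Adding [t] mod [b] to the digit in position [l] permutes the digit vectors;
it stands for drawing that digit afresh. *)
Definition rotate_digit (n b : nat) (b0 : (0 < b)%N) (l : 'I_n) (t : nat)
    (y : {ffun 'I_n -> 'I_b}) : {ffun 'I_n -> 'I_b} :=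
  [ffun k => if k == l then Ordinal (ltn_pmod (y k + t) b0) else y k].

Lemma add_mod_inj (b w : nat) : (0 < b)%N ->
  forall u v : 'I_b, w + u = w + v %[mod b] -> u = v.
Proof.
move=> b0 u v /eqP; rewrite eqn_modDl !modn_small// => /eqP.
exact: val_inj.
Qed.

Lemma rotate_digit_inj (n b : nat) (b0 : (0 < b)%N) (l : 'I_n) (t : nat) :
  injective (rotate_digit b0 l t).
Proof.
move=> y z /ffunP yz; apply/ffunP => k; have := yz k; rewrite !ffunE.
case: eqP => // _ /(congr1 val) /= eyz.
by apply: (@add_mod_inj b t) => //; rewrite addnC eyz addnC.
Qed.

Lemma sum_rotate (R : realType) (b w : nat) (phi : nat -> R) : (0 < b)%N ->
  \sum_(t < b) phi ((w + t) %% b)%N = \sum_(s < b) phi s.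
Proof.
move=> b0; rewrite [RHS](reindex_inj (h := fun t : 'I_b => Ordinal (ltn_pmod (w + t) b0)))//.
by move=> u v /(congr1 val)/= uv; exact: (@add_mod_inj b w).
Qed.

(** A residue [W] mod [b] that turns with digit [l] is uniform given any [psi]
that ignores this digit: average over the [b] rotations first. It applies both
to [W] = the digit itself and to [W] = the digit sum. *)
Lemma avg_resample (R : realType) (n b : nat) (b0 : (0 < b)%N) (l : 'I_n)
    (W : {ffun 'I_n -> 'I_b} -> nat) (psi : {ffun 'I_n -> 'I_b} -> R)
    (phi : nat -> R) :
  (forall t y, W (rotate_digit b0 l t y) = W y + t %[mod b]) ->
  (forall t y, psi (rotate_digit b0 l t y) = psi y) ->
  avg (fun y => psi y * phi (W y %% b)%N) = avg psi * avg (fun s : 'I_b => phi s).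
Proof.
move=> hW hpsi; rewrite /avg card_ord.
set S := \sum_y _.
have bR : b%:R != 0 :> R by rewrite pnatr_eq0 -lt0n.
have -> : S = (\sum_y psi y) * (\sum_(s < b) phi s) / b%:R; last first.
  by rewrite mulf_div -mulrA -invfM [X in _ / X]mulrC.
apply: (mulIf bR); rewrite mulfVK// mulr_natr -[in LHS](card_ord b) -sumr_const.
have St (t : nat) : S = \sum_y psi y * phi ((W y + t) %% b)%N.
  rewrite /S (reindex_inj (@rotate_digit_inj n b b0 l t)).
  by apply: eq_bigr => y _; rewrite hW hpsi.
rewrite (eq_bigr (fun t : 'I_b => \sum_y psi y * phi ((W y + t) %% b)%N)); last first.
  by move=> t _; exact: St.
rewrite exchange_big mulr_suml; apply: eq_bigr => y _.
by rewrite -mulr_sumr sum_rotate.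
Qed.

Definition ctr (R : realType) (b : nat) (s : nat) : R := s%:R - (b%:R - 1) / 2.

Lemma avg_ctr (R : realType) (b : nat) : (0 < b)%N ->
  avg (fun s : 'I_b => ctr R b s) = 0.
Proof.
move=> b0; rewrite /avg /ctr.
have sE c m : \sum_(s < m) (s%:R - c) = m%:R * ((m%:R - 1) / 2 - c) :> R.
  elim: m => [|m IH]; first by rewrite big_ord0 mul0r.
  by rewrite big_ord_recr /= IH -natr1; field.
by rewrite sE subrr mulr0 mul0r.
Qed.

Lemma avg_ctr2 (R : realType) (b : nat) : (0 < b)%N ->
  avg (fun s : 'I_b => ctr R b s ^+ 2) = (b%:R ^+ 2 - 1) / 12.
Proof.
move=> b0; rewrite /avg /ctr card_ord.
have sE c m : \sum_(s < m) (s%:R - c) ^+ 2 =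
    m%:R * ((m%:R - 1) * (2 * m%:R - 1) / 6 - c * (m%:R - 1) + c ^+ 2) :> R.
  elim: m => [|m IH]; first by rewrite big_ord0 mul0r.
  by rewrite big_ord_recr /= IH -natr1; field.
rewrite sE; field.
by rewrite pnatr_eq0 -lt0n.
Qed.

(** * The one-step noise *)

Section noise.
Variables (R : realType) (n b : nat) (b0 : (0 < b)%N).
Implicit Types y : {ffun 'I_n -> 'I_b}.

Let Z (x a : nat) y : nat := (x + \sum_(l < n) y l + a)%N.

(** The term [D] of the one-step identity, for current carry [x] and shift
[a]. *)
Definition noise (x a : nat) y : R :=
  \sum_(l < n) ctr R b (y l) - ctr R b ((x + \sum_(l < n) y l + a) %% b)%N.

Let Zrot x a l t y : Z x a (rotate_digit b0 l t y) = Z x a y + t %[mod b].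
Proof.
rewrite /Z (bigD1 l)//= [in RHS](bigD1 l)//= ffunE eqxx/=.
rewrite (eq_bigr (fun k => y k : nat)); last first.
  by move=> k kl; rewrite ffunE (negbTE kl).
set r := (\sum_(_ < n | _) _)%N.
have -> : (x + ((y l + t) %% b + r) + a = (y l + t) %% b + (x + r + a))%N by lia.
rewrite modnDml; congr (_ %% _)%N; lia.
Qed.

Let digit_rot l t y : (rotate_digit b0 l t y l : nat) = (y l + t)%N %[mod b].
Proof. by rewrite ffunE eqxx /= modn_mod. Qed.

Let digit_rot_neq l k t y : k != l -> rotate_digit b0 l t y k = y k.
Proof. by move=> kl; rewrite ffunE (negbTE kl). Qed.

Let card_gt0 : (0 < #|{: {ffun 'I_n -> 'I_b}}|)%N.
Proof. by rewrite card_ffun !card_ord expn_gt0 b0. Qed.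

Let avg1 : avg (fun _ : {ffun 'I_n -> 'I_b} => 1) = 1 :> R.
Proof. exact: avg_cst. Qed.

Let avg_digit (phi : nat -> R) l :
  avg (fun y => phi (y l)) = avg (fun s : 'I_b => phi s).
Proof.
rewrite -[RHS]mul1r -avg1 -(@avg_resample R n b b0 l (fun y => y l))//.
by apply: eq_avg => y; rewrite mul1r modn_small.
Qed.

Let avg_rem (phi : nat -> R) x a : (0 < n)%N ->
  avg (fun y => phi (Z x a y %% b)%N) = avg (fun s : 'I_b => phi s).
Proof.
move=> n0; rewrite -[RHS]mul1r -avg1.
rewrite -(@avg_resample R n b b0 (Ordinal n0) (Z x a))//.
by apply: eq_avg => y; rewrite mul1r.
Qed.

Lemma avg_noise x a : (0 < n)%N -> avg (noise x a) = 0.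
Proof.
move=> n0; rewrite /noise avgD avg_sum big1; last first.
  by move=> l _; rewrite avg_digit avg_ctr.
rewrite add0r; under eq_avg do rewrite -mulN1r.
by rewrite avgZ (avg_rem _ x a n0) avg_ctr// mulr0.
Qed.

Let avg_digit_digit l k :
  avg (fun y => ctr R b (y k) * ctr R b (y l)) =
  (b%:R ^+ 2 - 1) / 12 *+ (k == l).
Proof.
have [->|kl] := eqVneq k l.
  under eq_avg do rewrite -expr2.
  by rewrite (avg_digit (fun s => ctr R b s ^+ 2)) avg_ctr2.
rewrite -[RHS](mulr0 (avg (fun y => ctr R b (y k)))) -(avg_ctr R b0).
rewrite -(@avg_resample R n b b0 l (fun y => y l))//.
  by apply: eq_avg => y; rewrite modn_small.
by move=> t y; rewrite digit_rot_neq.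
Qed.

(* The digit rotated here is one different from k, so two digits are needed. *)
Let avg_digit_rem x a k : (1 < n)%N ->
  avg (fun y => ctr R b (y k) * ctr R b (Z x a y %% b)%N) = 0.
Proof.
move=> n1; have [l kl] : exists l : 'I_n, k != l.
  have n0 : (0 < n)%N by lia.
  have [k0|k0] := eqVneq (k : nat) 0%N.
    by exists (Ordinal n1); apply/eqP => /(congr1 val)/=; rewrite k0.
  by exists (Ordinal n0); apply: contra_neq k0 => ->.
rewrite (@avg_resample R n b b0 l (Z x a))//.
  by rewrite avg_ctr// mulr0.
by move=> t y; rewrite digit_rot_neq.
Qed.

(** The [n] digits and the remainder are pairwise uncorrelated, so their [n+1]
equal variances add up. *)
Lemma avg_noise2 x a : (1 < n)%N ->
  avg (fun y => noise x a y ^+ 2) = (n%:R + 1) * ((b%:R ^+ 2 - 1) / 12).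
Proof.
move=> n1; have n0 : (0 < n)%N by lia.
pose q y := ctr R b (Z x a y %% b)%N.
under eq_avg => y.
  rewrite (_ : _ ^+ 2 = (\sum_k \sum_l ctr R b (y k) * ctr R b (y l)
      + (- 2) * \sum_k ctr R b (y k) * q y) + q y ^+ 2); last first.
    rewrite /noise -/(q y) -mulr_suml.
    under [X in _ = X + _ + _]eq_bigr do rewrite -mulr_sumr.
    by rewrite -mulr_suml; ring.
  over.
rewrite 2!avgD avgZ !avg_sum (avg_rem (fun s => ctr R b s ^+ 2) x a n0) avg_ctr2//.
rewrite [X in -2 * X]big1; last by move=> k _; exact: avg_digit_rem.
rewrite (eq_bigr (fun=> (b%:R ^+ 2 - 1) / 12)); last first.
  move=> k _; rewrite avg_sum (bigD1 k)//= avg_digit_digit eqxx mulr1n.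
  by rewrite big1 ?addr0// => l lk; rewrite avg_digit_digit eq_sym (negbTE lk).
by rewrite sumr_const card_ord -(mulr_natl _ n); ring.
Qed.

End noise.

(** * One step of the chain *)

Section one_step.
Variables (R : realType) (neg : bool) (b n : nat) (p : R).
Hypotheses (b2 : (2 <= b)%N) (p1 : 1 <= p).
Hypothesis hbp : exists2 m : nat, (1 <= m)%N & (b%:R - pm R neg) / p = m%:R.
Implicit Types y : {ffun 'I_n -> 'I_b}.

(** The integrality hypothesis makes the shift a natural number. The bounds are
exactly those that keep the carries in their state space. *)
Lemma shift_nat : exists2 a : nat, Defs.shift neg b p = a%:R &
  if p == 1 then a = (if neg then b else 0)%N else (a < b)%N.
Proof.
have [m m1 hm] := hbp; have p0 : 0 < p := lt_le_trans ltr01 p1.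
have pm_eq : b%:R - pm R neg = m%:R * p by rewrite -hm mulfVK// gt_eqF.
rewrite /Defs.shift; move: hm pm_eq; rewrite /pm; case: neg => hm pm_eq.
  exists m.-1.
    have -> : (b%:R + 1) / p = m%:R by rewrite -hm opprK.
    by rewrite -{1}(prednK m1) -natr1 addrK.
  have [p_eq1|p_neq1] := eqVneq p 1.
    suff : m = b.+1 by move=> ->.
    move: pm_eq; rewrite p_eq1 mulr1 opprK natr1 => /eqP.
    by rewrite eqr_nat => /eqP.
  suff : (m < b.+1)%N by lia.
  rewrite -(ltr_nat R) -natr1 -[X in _ + X]opprK pm_eq.
  rewrite -[X in X < _]mulr1.
  by rewrite ltr_pM2l ?ltr0n// lt_neqAle eq_sym p_neq1.
have mb : (m <= b.-1)%N.
  rewrite -(ler_nat R) -subn1 natrB; last lia.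
  by rewrite pm_eq ler_peMr.
exists (b.-1 - m)%N.
  by rewrite mulrBr mulr1 mul1r hm natrB// -subn1 natrB ?(ltnW b2).
have [p_eq1|p_neq1] := eqVneq p 1; last by lia.
move: pm_eq; rewrite p_eq1 mulr1 => /eqP.
rewrite subr_eq natr1 eqr_nat; lia.
Qed.

Lemma sum_digits_le y : (\sum_(l < n) y l <= n * b.-1)%N.
Proof.
rewrite -[n in leqRHS]card_ord -sum_nat_const; apply: leq_sum => l _.
have := ltn_ord (y l); lia.
Qed.

(** The functional form of the relation [carry]; see [carryE]. *)
Definition next_carry (a : nat) y (x : nat) : nat :=
  let q := ((x + \sum_(l < n) y l + a) %/ b)%N in if neg then (n - q)%N else q.

Section shift.
Variable a : nat.
Hypothesis aE : Defs.shift neg b p = a%:R.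
Hypothesis a_bound : if p == 1 then a = (if neg then b else 0)%N else (a < b)%N.

Lemma quotient_le y x : inC p n x -> ((x + \sum_(l < n) y l + a) %/ b <= n)%N.
Proof.
have b0 : (0 < b)%N by lia.
move=> hx; rewrite -ltnS ltn_divLR//; move: hx a_bound (sum_digits_le y).
rewrite /inC.
case: ifP => _; first case: neg; nia.
Qed.

(** For [p = 1] the state [n] must be excluded: with the positive base the total
stays below [n * b], with the negative one the shift [b] makes the quotient
positive. *)
Lemma next_carry_inC y x : inC p n x -> inC p n (next_carry a y x).
Proof.
move=> hx; have qn := quotient_le y hx.
have b0 : (0 < b)%N by lia.
move: qn hx a_bound (sum_digits_le y); rewrite /next_carry /inC.
case: ifP => _ qn hx.
  case: neg => aEq hs.
    suff : (0 < (x + \sum_(l < n) y l + a) %/ b)%N by lia.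
    by rewrite divn_gt0// aEq; lia.
  rewrite ltn_divLR// aEq; nia.
by case: neg => // _ _; rewrite leq_subr.
Qed.

Lemma carryE y x j : inC p n x -> (j <= n)%N ->
  carry neg p y x j = (j == next_carry a y x).
Proof.
move=> hx jn; have qn := quotient_le y hx.
have b0 : (0 < b)%N by lia.
have carry_nat (s : 'I_b) :
  (x%:R + \sum_(l < n) (y l)%:R + Defs.shift neg b p ==
      (if neg then n%:R - j%:R else j%:R) * b%:R + s%:R :> R) =
  (x + \sum_(l < n) y l + a == (if neg then n - j else j) * b + s)%N.
  rewrite aE -natr_sum -(eqr_nat R) !natrD natrM; congr (_ == _ * _ + _).
  by case: neg => //; rewrite natrB.
rewrite /carry /next_carry; move: qn carry_nat.
set z := (x + _ + a)%N => qn carry_nat; apply/existsP/eqP => [[s]|jE].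
  rewrite carry_nat => /eqP ->.
  by rewrite divnMDl// divn_small// addn0; case: neg => //; rewrite subKn.
exists (Ordinal (ltn_pmod z b0)); rewrite carry_nat /= {1}(divn_eq z b).
apply/eqP; congr (_ * _ + _)%N; rewrite jE; case: neg => //.
by rewrite subKn.
Qed.

Lemma sum_trans (f : nat -> R) x : inC p n x ->
  \sum_(j < n.+1) trans neg b n p x j * f j =
  avg (fun y => f (next_carry a y x)).
Proof.
move=> hx; rewrite /trans /avg card_ffun !card_ord.
under eq_bigr => j _.
  rewrite -sum1_card natr_sum big_mkcond/= mulrAC mulr_suml.
  rewrite (eq_bigr (fun y => if j == next_carry a y x :> nat then f j else 0)); last first.
    move=> y _; rewrite inE carryE//; last by rewrite -ltnS.
    by case: ifP; rewrite ?mul1r ?mul0r.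
  over.
rewrite -mulr_suml exchange_big/=; congr (_ / _).
apply: eq_bigr => y _.
have hq : (next_carry a y x < n.+1)%N.
  by move: (quotient_le y hx); rewrite ltnS /next_carry; case: neg => //; rewrite leq_subr.
rewrite (bigD1 (Ordinal hq))//= eqxx big1 ?addr0// => j; rewrite -val_eqE/=.
by move=> /negbTE ->.
Qed.

Lemma trans_out x j : inC p n x -> (j <= n)%N -> ~~ inC p n j ->
  trans neg b n p x j = 0.
Proof.
move=> hx jn jC; rewrite /trans (_ : #|_| = 0%N) ?mul0r//.
apply/eqP/pred0P => y; rewrite /= carryE//; apply/negbTE.
by apply: contraNneq jC => ->; exact: next_carry_inC.
Qed.

(** The one-step identity: [limit_mean] below is the fixed point that absorbs
the shift and the means of the digits and of the remainder. *)
Lemma next_carry_noise y x : inC p n x ->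
  (next_carry a y x)%:R = (n%:R + 1) / 2 - 1 / p +
    (x%:R - ((n%:R + 1) / 2 - 1 / p) + noise R x a y) / (pm R neg * b%:R) :> R.
Proof.
move=> hx; have qn := quotient_le y hx.
rewrite /next_carry /noise /ctr.
move: qn; set q := (_ %/ b)%N => qn.
have zE : x%:R + \sum_(l < n) (y l)%:R + a%:R =
    q%:R * b%:R + ((x + \sum_(l < n) y l + a) %% b)%:R :> R.
  by rewrite -natrM -natrD -divn_eq !natrD natr_sum.
have bR : b%:R != 0 :> R by rewrite pnatr_eq0; lia.
have pR : p != 0 by rewrite gt_eqF// (lt_le_trans ltr01).
rewrite sumrB sumr_const card_ord -(mulr_natl _ n).
have {zE}-> : \sum_(l < n) (y l)%:R = q%:R * b%:R
    + ((x + \sum_(l < n) y l + a) %% b)%:R - x%:R - a%:R :> R by rewrite -zE; ring.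
rewrite -aE /Defs.shift /pm; case: neg; rewrite ?natrB//; field; by rewrite bR pR.
Qed.

End shift.

Definition limit_mean : R := (n%:R + 1) / 2 - 1 / p.
Definition limit_var : R := (n%:R + 1) / 12.

Lemma step_mean x (c : R) : (0 < n)%N -> inC p n x ->
  \sum_(j < n.+1) trans neg b n p x j * (j%:R - c) =
  (x%:R - limit_mean) / (pm R neg * b%:R) + (limit_mean - c).
Proof.
move=> n0 hx; have [a aE a_bound] := shift_nat.
have b0 : (0 < b)%N by lia.
rewrite (sum_trans aE a_bound (fun j => j%:R - c) hx).
set B := pm R neg * b%:R.
rewrite (eq_avg (h := fun y => (x%:R - limit_mean) / B + (limit_mean - c)
    + B^-1 * noise R x a y)); last first.
  by move=> y; rewrite (next_carry_noise aE a_bound y hx) -/limit_mean -/B; ring.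
have card0 : (0 < #|{: {ffun 'I_n -> 'I_b}}|)%N.
  by rewrite card_ffun !card_ord expn_gt0 b0.
by rewrite avgD avg_cst// avgZ avg_noise// mulr0 addr0.
Qed.

(** The noise variance does not depend on [x], so one step contributes the
same amount wherever the chain is. *)
Lemma step_square x (c : R) : (1 < n)%N -> inC p n x ->
  let B := pm R neg * b%:R in
  \sum_(j < n.+1) trans neg b n p x j * (j%:R - c) ^+ 2 =
  ((x%:R - limit_mean) / B + (limit_mean - c)) ^+ 2
    + limit_var * (1 - 1 / B ^+ 2).
Proof.
move=> n1 hx B; have [a aE a_bound] := shift_nat.
have b0 : (0 < b)%N by lia.
have BE : B ^+ 2 = b%:R ^+ 2 by rewrite /B /pm; case: neg; ring.
have bR : b%:R != 0 :> R by rewrite pnatr_eq0; lia.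
rewrite (sum_trans aE a_bound (fun j => (j%:R - c) ^+ 2) hx).
pose u := (x%:R - limit_mean) / B + (limit_mean - c).
rewrite (eq_avg (h := fun y => (u ^+ 2 + (2 * u / B) * noise R x a y)
    + B^-1 ^+ 2 * noise R x a y ^+ 2)); last first.
  move=> y; rewrite (next_carry_noise aE a_bound y hx) -/limit_mean -/B /u.
  by ring.
have card0 : (0 < #|{: {ffun 'I_n -> 'I_b}}|)%N.
  by rewrite card_ffun !card_ord expn_gt0 b0.
rewrite 2!avgD avg_cst// !avgZ avg_noise//; last by lia.
rewrite avg_noise2// mulr0 addr0 /limit_var exprVn BE -/u; field.
by rewrite bR.
Qed.

End one_step.

(** * From transition probabilities to expectations *)

Lemma expectation_finite (R : realType) (d : measure_display)
    (T : measurableType d) (P : probability T R) (F : finType) (H : T -> F)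
    (g : F -> R) : (forall x, measurable (H @^-1` [set x])) ->
  ('E_P[g \o H])%E = (\sum_x g x * fine (P (H @^-1` [set x])))%:E.
Proof.
move=> mH; rewrite unlock.
under eq_integral => w _.
  rewrite (_ : (_ w)%:E = \sum_x (g x)%:E * (\1_(H @^-1` [set x]) w)%:E)%E; last first.
    rewrite (bigD1 (H w))//= big1 ?adde0; last first.
      move=> x xH; rewrite indicE memNset ?mule0//= => xE.
      by rewrite xE eqxx in xH.
    by rewrite indicE mem_set// mule1.
  over.
rewrite integral_sum//; last first.
  move=> x; apply: integrableZl => //.
  by apply: integrable_indic => //; rewrite -ge0_fin_numE// fin_num_measure.
rewrite -sumEFin; apply: eq_bigr => x _.
rewrite integralZl//; last first.
  by apply: integrable_indic => //; rewrite -ge0_fin_numE// fin_num_measure.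
by rewrite integral_indic// setIT EFinM fineK// fin_num_measure.
Qed.

Section chain.
Variables (R : realType) (d : measure_display) (T : measurableType d).
Variables (P : probability T R) (neg : bool) (b n : nat) (p : R).
Variable kappa : nat -> {RV P >-> nat}.
Hypotheses (b2 : (2 <= b)%N) (p1 : 1 <= p).
Hypothesis hbp : exists2 m : nat, (1 <= m)%N & (b%:R - pm R neg) / p = m%:R.
Hypothesis hkappa : carries_process neg b n p kappa.

Lemma carry_le k w : (kappa k w <= n)%N.
Proof. by have := hkappa.1 k w; rewrite /inC; case: ifP => // _ /ltnW. Qed.

Definition trajectory (k : nat) (w : T) : {ffun 'I_k.+1 -> 'I_n.+1} :=
  [ffun l : 'I_k.+1 => inord (kappa l w)].

Lemma trajectoryE k (w : T) l : (l <= k)%N ->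
  trajectory k w (inord l) = kappa l w :> nat.
Proof. by move=> lk; rewrite ffunE !inordK ?ltnS ?carry_le. Qed.

Lemma trajectory_preimage k (x : {ffun 'I_k.+1 -> 'I_n.+1}) :
  trajectory k @^-1` [set x] =
  [set w | forall l, (l <= k)%N -> kappa l w = x (inord l)].
Proof.
apply/seteqP; split => w /=.
  by move=> <- l lk; rewrite trajectoryE.
move=> hw; apply/ffunP => l; apply/val_inj.
have lk : (l <= k)%N by rewrite -ltnS.
by rewrite -[l]inord_val [LHS]trajectoryE// hw.
Qed.

Lemma measurable_history k (x : nat -> nat) :
  measurable [set w | forall l, (l <= k)%N -> kappa l w = x l].
Proof.
rewrite (_ : mkset _ = \bigcap_(l in [set l | (l <= k)%N]) (kappa l @^-1` [set x l])).
  by apply: bigcap_measurable => [|l _]; [exists 0%N|exact: measurable_level].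
by apply/seteqP; split.
Qed.

Lemma measurable_trajectory k x : measurable (trajectory k @^-1` [set x]).
Proof.
rewrite trajectory_preimage.
exact: (measurable_history k (fun l => x (inord l) : nat)).
Qed.

Lemma trajectory_outside k (x : {ffun 'I_k.+1 -> 'I_n.+1}) l :
  (l <= k)%N -> ~~ inC p n (x (inord l)) ->
  P (trajectory k @^-1` [set x]) = 0%E.
Proof.
move=> lk; apply: contraNeq => Px0; have [w] : trajectory k @^-1` [set x] !=set0.
  by apply/set0P; apply: contra_neq Px0 => ->; rewrite measure0.
by rewrite trajectory_preimage => /(_ l lk) <-; exact: hkappa.1.
Qed.

(** The Markov property, extended to all trajectories in [{0..n}]: those that
leave the state space have probability zero, and a transition out of it has
probability zero too. *)
Lemma prob_extend k (x : {ffun 'I_k.+1 -> 'I_n.+1}) (j : 'I_n.+1) :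
  P ((fun w => (trajectory k w, inord (kappa k.+1 w))) @^-1` [set (x, j)]) =
  (P (trajectory k @^-1` [set x]) * (trans neg b n p (x (inord k)) j)%:E)%E.
Proof.
(* Constant after time k, so that it lies in the state space at all times. *)
pose X l : nat := if (l <= k)%N then x (inord l) else j.
have extE : (fun w => (trajectory k w, inord (kappa k.+1 w))) @^-1` [set (x, j)]
    = [set w | forall l, (l <= k.+1)%N -> kappa l w = X l].
  apply/seteqP; split => w /=.
    case=> tx jE l; rewrite leq_eqVlt /X ltnS => /predU1P[->|lk].
      by rewrite ltnn -jE inordK// ltnS carry_le.
    by rewrite lk -tx trajectoryE.
  move=> hw; congr (_, _).
    have : (trajectory k @^-1` [set x]) w.
      rewrite trajectory_preimage => l lk.
      by rewrite (hw l (leqW lk)) /X lk.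
    by [].
  by apply/val_inj; rewrite /= (hw k.+1 (leqnn _)) /X ltnn inordK.
have prefixE : trajectory k @^-1` [set x] =
    [set w | forall l, (l <= k)%N -> kappa l w = X l].
  rewrite trajectory_preimage; apply/seteqP; split => w hw l lk.
    by rewrite /X lk; exact: hw.
  by have := hw l lk; rewrite /X lk.
have [/forallP xC|] := boolP [forall l, inC p n (x l)]; last first.
  rewrite negb_forall => /existsP[l xlC].
  have lk : (l <= k)%N by rewrite -ltnS.
  have P0 : P (trajectory k @^-1` [set x]) = 0%E.
    by apply: (trajectory_outside (l := l)) => //; rewrite inord_val.
  rewrite P0 mul0e; apply/eqP; rewrite -measure_le0 -P0 le_measure ?inE//.
  - by rewrite extE; exact: measurable_history.
  - exact: measurable_trajectory.
  - by move=> w /= [].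
have [jC|jC] := boolP (inC p n j); last first.
  have [a aE a_bound] := shift_nat b2 p1 hbp.
  rewrite (trans_out b2 p1 aE a_bound) ?mule0 -1?ltnS//.
  rewrite (_ : _ @^-1` _ = set0) ?measure0//; apply/seteqP; split => w //=.
  case=> _ jE; move: jC; rewrite -jE inordK ?ltnS ?carry_le//.
  by rewrite (hkappa.1 k.+1 w).
have XC l : inC p n (X l) by rewrite /X; case: ifP.
rewrite extE prefixE (hkappa.2 k X XC).
by congr (_ * (trans _ _ _ _ _ _)%:E)%E; rewrite /X ?leqnn// ltnn.
Qed.

(** If one step sends [f] to the affine expression [alpha * g + beta], then
so does conditioning on the past, here tested against a function [h] of one
earlier carry: [h = 1] serves for the mean and the variance, a centred [h] for
the covariance. *)
Lemma markov_step (k s : nat) (h f g : nat -> R) (alpha beta : R) :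
  (s <= k)%N ->
  (forall x, inC p n x ->
     \sum_(j < n.+1) trans neg b n p x j * f j = alpha * g x + beta) ->
  ('E_P[fun w => (h (kappa s w) * f (kappa k.+1 w))%R])%E =
  (alpha%:E * 'E_P[fun w => (h (kappa s w) * g (kappa k w))%R]
     + beta%:E * 'E_P[fun w => h (kappa s w)])%E.
Proof.
move=> sk step.
pose H2 w := (trajectory k w, inord (kappa k.+1 w) : 'I_n.+1).
pose q x := fine (P (trajectory k @^-1` [set x])).
have -> : (fun w => h (kappa s w) * f (kappa k.+1 w)) =
    (fun z : {ffun 'I_k.+1 -> 'I_n.+1} * 'I_n.+1 =>
       h (z.1 (inord s)) * f z.2) \o H2.
  by apply/funext => w /=; rewrite trajectoryE// inordK// ltnS carry_le.
have -> : (fun w => h (kappa s w) * g (kappa k w)) =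
    (fun x : {ffun 'I_k.+1 -> 'I_n.+1} =>
       h (x (inord s)) * g (x (inord k))) \o trajectory k.
  by apply/funext => w /=; rewrite !trajectoryE.
have -> : (fun w => h (kappa s w)) =
    (fun x : {ffun 'I_k.+1 -> 'I_n.+1} => h (x (inord s))) \o trajectory k.
  by apply/funext => w /=; rewrite !trajectoryE.
have mH2 z : measurable (H2 @^-1` [set z]).
  case: z => x j; rewrite (_ : _ @^-1` _ =
    trajectory k @^-1` [set x] `&` kappa k.+1 @^-1` [set (j : nat)]).
    by apply: measurableI; [exact: measurable_trajectory|exact: measurable_level].
  apply/seteqP; split => w /= [tx jE].
    by split=> //; rewrite -jE inordK// ltnS carry_le.
  by rewrite /H2 tx jE inord_val.
rewrite !expectation_finite//; try exact: measurable_trajectory.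
rewrite -!EFinM -EFinD; congr (_%:E).
rewrite !mulr_sumr -big_split/=.
pose G (x : {ffun 'I_k.+1 -> 'I_n.+1}) (j : 'I_n.+1) : R :=
  h (x (inord s)) * f j * fine (P (H2 @^-1` [set (x, j)])).
rewrite (eq_bigr (fun z => G z.1 z.2)); last by case.
rewrite -(pair_bigA _ G)/= /G.
apply: eq_bigr => x _; rewrite -/(q x).
under eq_bigr => j _.
  rewrite prob_extend fineM// ?fin_num_measure//; last exact: measurable_trajectory.
  rewrite -/(q x) /= (_ : _ * _ = h (x (inord s)) * q x *
    (trans neg b n p (x (inord k)) j * f j)); last by ring.
  over.
rewrite -mulr_sumr; have [xC|xC] := boolP (inC p n (x (inord k))).
  by rewrite step//; ring.
by rewrite /q (trajectory_outside (leqnn k) xC)/= !(mulr0, mul0r) addr0.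
Qed.

End chain.

(** * Conditioning on the initial carry *)

Section conditioning.
Variables (R : realType) (d : measure_display) (T : measurableType d).
Variables (P : probability T R) (X : {RV P >-> nat}) (i : nat).
Hypothesis hPi : (0 < P (X @^-1` [set i]))%E.

Lemma cond_probE (U : set T) : cond_prob X i U =
  (P (U `&` X @^-1` [set i]) * ((fine (P (X @^-1` [set i])))^-1)%:E)%E.
Proof.
rewrite /cond_prob/= /mnormalize/= /mrestr setTI gt_eqF//= lt_eqF//.
by rewrite -ge0_fin_numE// fin_num_measure//; exact: measurable_level.
Qed.

Lemma cond_prob_level : cond_prob X i (X @^-1` [set i]) = 1%E.
Proof.
rewrite cond_probE setIid -[P _ in LHS]fineK -?EFinM ?divff//.
  by rewrite gt_eqF// fine_gt0// hPi/= -ge0_fin_numE// fin_num_measure//; exact: measurable_level.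
by rewrite fin_num_measure//; exact: measurable_level.
Qed.

Lemma cond_prob_off j : j != i -> cond_prob X i (X @^-1` [set j]) = 0%E.
Proof.
move=> ji; rewrite cond_probE (_ : _ `&` _ = set0) ?measure0 ?mul0e//.
by apply/seteqP; split => w //= [-> ij]; rewrite ij eqxx in ji.
Qed.

End conditioning.

(** A history either starts at [i], and then conditioning divides its
probability by a constant, or it becomes null; the product rule survives in both
cases. *)
Lemma cond_carries_process (R : realType) (d : measure_display)
    (T : measurableType d) (P : probability T R) (neg : bool) (b n : nat)
    (p : R) (kappa : nat -> {RV P >-> nat}) (i : nat) :
  (0 < P (kappa 0%N @^-1` [set i]))%E ->
  carries_process neg b n p kappa ->
  carries_process (P := cond_prob (kappa 0%N) i) neg b n p kappa.
Proof.
move=> hPi [hC hP]; split => // k x xC; rewrite !(cond_probE hPi).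
have [x0|x0] := eqVneq (x 0%N) i; last first.
  have off m : [set w | forall l, (l <= m)%N -> kappa l w = x l]
      `&` kappa 0%N @^-1` [set i] = set0.
    apply/seteqP; split => w //= [/(_ 0%N (leq0n _)) -> xi].
    by rewrite xi eqxx in x0.
  by rewrite !off measure0 !mul0e.
have on m : [set w | forall l, (l <= m)%N -> kappa l w = x l]
    `&` kappa 0%N @^-1` [set i] =
    [set w | forall l, (l <= m)%N -> kappa l w = x l].
  by apply: setIidl => w /= /(_ 0%N (leq0n _)); rewrite x0.
by rewrite !on hP// muleAC.
Qed.

Lemma expectation_start (R : realType) (d : measure_display)
    (T : measurableType d) (P : probability T R) (X : {RV P >-> nat}) (i n : nat)
    (f : nat -> R) : (forall w, X w <= n)%N ->
  (0 < P (X @^-1` [set i]))%E ->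
  ('E_(cond_prob X i)[fun w => f (X w)])%E = (f i)%:E.
Proof.
move=> Xn hPi.
have i_n : (i < n.+1)%N.
  have [w <-] : X @^-1` [set i] !=set0.
    by apply/set0P; apply: contraTneq hPi => ->; rewrite measure0 ltxx.
  exact: Xn.
pose H w : 'I_n.+1 := inord (X w).
have HE (j : 'I_n.+1) : H @^-1` [set j] = X @^-1` [set (j : nat)].
  apply/seteqP; split => w /=; first by move=> <-; rewrite inordK ?ltnS.
  by move=> XE; rewrite /H XE inord_val.
rewrite (_ : (fun w => _) = (fun j : 'I_n.+1 => f j) \o H); last first.
  by apply/funext => w /=; rewrite inordK ?ltnS.
rewrite expectation_finite; last by move=> j; rewrite HE; exact: measurable_level.
rewrite (bigD1 (Ordinal i_n))//= HE cond_prob_level// mulr1 big1 ?addr0//.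
move=> j; rewrite -val_eqE/= => ji.
by rewrite HE cond_prob_off// mulr0.
Qed.

(** * Mean, covariance and variance along the chain *)

Section centred_moments.
Variables (R : realType) (d : measure_display) (T : measurableType d).
Variables (P : probability T R) (neg : bool) (b n : nat) (p : R).
Variables (kappa : nat -> {RV P >-> nat}) (i : nat).
Hypotheses (b2 : (2 <= b)%N) (n1 : (1 <= n)%N) (p1 : 1 <= p).
Hypothesis hbp : exists2 m : nat, (1 <= m)%N & (b%:R - pm R neg) / p = m%:R.
Hypothesis hkappa : carries_process neg b n p kappa.
Hypothesis start : forall f : nat -> R,
  ('E_P[fun w => f (kappa 0%N w)])%E = (f i)%:E.

Let B : R := pm R neg * b%:R.

Let B_neq0 : B != 0.
Proof.
rewrite mulf_neq0//; first by rewrite /pm; case: neg; rewrite ?oppr_eq0 oner_eq0.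
by rewrite pnatr_eq0; lia.
Qed.

Definition mean_at (k : nat) : R :=
  limit_mean n p + (i%:R - limit_mean n p) / B ^+ k.

Let mean_atS k : (mean_at k - limit_mean n p) / B = mean_at k.+1 - limit_mean n p.
Proof. by rewrite /mean_at exprS; field; rewrite B_neq0 expf_neq0. Qed.

Lemma expectation_carry k :
  ('E_P[fun w => (kappa k w)%:R : R])%E = (mean_at k)%:E.
Proof.
elim: k => [|k IH].
  by rewrite (start (fun j => j%:R)) /mean_at expr0 divr1 subrKC.
have -> : (fun w => (kappa k.+1 w)%:R : R) =
    (fun w => 1 * (fun j => j%:R : R) (kappa k.+1 w)).
  by apply/funext => w; rewrite mul1r.
rewrite (markov_step b2 p1 hbp hkappa (fun=> 1) (leq0n k) (g := fun j => j%:R)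
  (alpha := B^-1) (beta := limit_mean n p - limit_mean n p / B)); last first.
  move=> x xC; have := step_mean b2 p1 hbp 0 n1 xC; rewrite -/B subr0.
  under eq_bigr do rewrite subr0.
  by move=> ->; ring.
under [X in ('E_P[X])%E]eq_fun do rewrite mul1r.
rewrite IH expectation_cst mule1 -EFinM -EFinD; congr (_%:E).
by apply/eqP; rewrite -subr_eq0; apply/eqP; have := mean_atS k; lra.
Qed.

Let covariance_carry s k : covariance P (fun w => (kappa s w)%:R : R)
    (fun w => (kappa k w)%:R : R) =
  ('E_P[fun w => (((kappa s w)%:R - mean_at s) * ((kappa k w)%:R - mean_at k))%R])%E.
Proof. by rewrite unlock !expectation_carry. Qed.

(** Advancing the later time by one step divides its centred carry by [B], while
the earlier factor is a function of the past. *)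
Lemma covariance_carries r s :
  covariance P (fun w => (kappa s w)%:R : R) (fun w => (kappa (s + r)%N w)%:R : R) =
  ((1 / B ^+ r)%:E * 'V_P[fun w => (kappa s w)%:R : R])%E.
Proof.
rewrite /variance.
elim: r => [|r IH]; first by rewrite addn0 expr0 divr1 mul1e.
rewrite addnS covariance_carry.
rewrite (markov_step b2 p1 hbp hkappa (fun j => j%:R - mean_at s)
  (f := fun j => j%:R - mean_at (s + r).+1) (leq_addr r s)
  (g := fun j => j%:R - mean_at (s + r)) (alpha := B^-1) (beta := 0)); last first.
  move=> x xC; rewrite (step_mean b2 p1 hbp _ n1 xC) -/B.
  by have := mean_atS (s + r); lra.
rewrite mul0e adde0 -covariance_carry IH muleA -EFinM; congr (_%:E * _)%E.
by rewrite exprS; field; rewrite B_neq0 expf_neq0.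
Qed.

(** The recursion [V_(k+1) = V_k / B^2 + (n+1)/12 (1 - B^-2)] started from 0. *)
Lemma variance_carry k : (1 < n)%N ->
  ('V_P[fun w => (kappa k w)%:R : R])%E =
  (limit_var R n * (1 - 1 / B ^+ (2 * k)))%:E.
Proof.
move=> n2; rewrite /variance; elim: k => [|k IH].
  rewrite covariance_carry (start (fun j => (j%:R - mean_at 0) * (j%:R - mean_at 0))).
  by rewrite /mean_at !expr0 !divr1 subrKC !subrr !mulr0.
have -> : covariance P (fun w => (kappa k.+1 w)%:R : R) (fun w => (kappa k.+1 w)%:R : R)
   = ('E_P[fun w => (1 * (fun j => (j%:R - mean_at k.+1) ^+ 2) (kappa k.+1 w))%R])%E.
  by rewrite covariance_carry; congr expectation; apply/funext => w; rewrite mul1r.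
rewrite (markov_step b2 p1 hbp hkappa (fun=> 1) (leq0n k)
  (f := fun j => (j%:R - mean_at k.+1) ^+ 2)
  (g := fun j => (j%:R - mean_at k) ^+ 2) (alpha := (B ^+ 2)^-1)
  (beta := limit_var R n * (1 - 1 / B ^+ 2))); last first.
  move=> x xC; rewrite (step_square b2 p1 hbp _ n2 xC) -/B; congr (_ + _).
  rewrite -exprVn mulrC -exprMn; congr (_ ^+ 2).
  by have := mean_atS k; lra.
under [X in ('E_P[X])%E]eq_fun do rewrite mul1r expr2.
rewrite -covariance_carry IH expectation_cst mule1 -EFinM -EFinD; congr (_%:E).
rewrite mulnS exprD; field.
by rewrite B_neq0 expf_neq0.
Qed.

End centred_moments.

Unset Implicit Arguments.

(* Parts (2) and (3) fail for n = 1 (already the one-step variance does). *)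
Theorem theorem1p6 (R : realType) (d : measure_display) (T : measurableType d)
    (P : probability T R) (neg : bool) (b n : nat) (p : R)
    (kappa : nat -> {RV P >-> nat}) (i : nat)
    (hb : (2 <= b)%N) (hn : (1 <= n)%N) (hp : 1 <= p)
    (hbp : exists2 m : nat, (1 <= m)%N & (b%:R - pm R neg) / p = m%:R)
    (hkappa : carries_process neg b n p kappa)
    (hi : inC p n i) (hPi : (0 < P (kappa 0%N @^-1` [set i]))%E) :
  let Pi := cond_prob (kappa 0%N) i in
  let K k : T -> R := fun w => (kappa k w)%:R in
  let B : R := pm R neg * b%:R in
  [/\ forall r : nat,
        ('E_Pi[K r])%E =
          (1 / B ^+ r * (i%:R + 1 / p - (n%:R + 1) / 2)
            - 1 / p + (n%:R + 1) / 2)%:E,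
      (2 <= n)%N -> forall r : nat,
        ('V_Pi[K r])%E =
          ((n%:R + 1) / 12 * (1 - 1 / B ^+ (2 * r)))%:E
    & (2 <= n)%N -> forall r s : nat,
        covariance Pi (K s) (K (s + r)%N) =
          (1 / B ^+ r * ((n%:R + 1) / 12) * (1 - 1 / B ^+ (2 * s)))%:E].
Proof.
move=> Pi K B.
have hkappa' := cond_carries_process hPi hkappa.
have start (f : nat -> R) : ('E_Pi[fun w => f (kappa 0%N w)])%E = (f i)%:E.
  exact: (expectation_start f (carry_le hkappa 0) hPi).
have var_eq r : (2 <= n)%N -> ('V_Pi[K r])%E =
    ((n%:R + 1) / 12 * (1 - 1 / B ^+ (2 * r)))%:E.
  exact: (variance_carry hb hn hp hbp hkappa' start).
split=> [r|n2 r|n2 r s].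
- rewrite (expectation_carry hb hn hp hbp hkappa' start).
  by congr (_%:E); rewrite /mean_at /limit_mean -/B; ring.
- exact: (var_eq r n2).
- rewrite (covariance_carries hb hn hp hbp hkappa' start) var_eq// -EFinM.
  by congr (_%:E); rewrite -/B; ring.
Qed.
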